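(* Let $m,n\ge 1$ be integers, let $p_1,\dots,p_k$ be distinct primes including all primes dividing $mn$, and write $m=\prod_{i=1}^k p_i^{a_i}$, $n=\prod_{i=1}^k p_i^{b_i}$ with $a_i,b_i\ge 0$. Put $\delta_i=|b_i-a_i|$, $\delta=(\delta_1,\dots,\delta_k)$, $\sigma_i=\operatorname{sgn}(b_i-a_i)$, and for integer vectors $r=(r_1,\dots,r_k)$ with $0\le r_i\le\delta_i$ put $$N(r)=\prod_{i=1}^k p_i^{a_i+\sigma_i r_i},\qquad D(r)=\prod_{i=1}^k (a_i+\sigma_i r_i+1).$$ Fix $X\ge\max\{m,n\}$ and call a state $r$ admissible if $N(r)\le X$. Define $F$ on the states as follows: $F(r)=0$ for every inadmissible $r$; $F(0)=D(0)$; and for admissible $r\neq 0$, $$F(r)=\min\Bigl\{D(r),\ \max_{\substack{i:\ r_i>0\\ N(r-e_i)\le X}}F(r-e_i)\Bigr\},$$ where $e_i$ is the $i$-th standard unit vector and $\max\varnothing:=0$. Then $$F(\delta)=\mathcal G_X(m,n).$$ Moreover, the number of states (before excluding inadmissible ones) is $\prod_{i=1}^k(\delta_i+1)$.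
   Context: $d(n)$ denotes the number of positive divisors of $n$. A (directed exponent-lattice) geodesic from $m$ to $n$ is a finite sequence of positive integers starting at $m$ and ending at $n$ in which each step changes the exponent of exactly one prime by one unit, always in the direction of its target exponent (equivalently, it has the minimum length $\sum_i|b_i-a_i|$). For $X\ge\max\{m,n\}$, a geodesic is $X$-admissible if all its vertices $z$ satisfy $z\le X$. The optimal geodesic bottleneck is $$\mathcal G_X(m,n)=\max_{\gamma}\ \min_{z\in\gamma}d(z),$$ where $\gamma$ ranges over the $X$-admissible geodesics from $m$ to $n$ and $z\in\gamma$ ranges over all vertices, endpoints included. *)

(* Defs.v *)
From HB Require Import structures.
From mathcomp Require Import all_boot all_order all_algebra.
From mathcomp Require Import boolp classical_sets zify.
Set Implicit Arguments.
Unset Strict Implicit.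
Unset Printing Implicit Defensive.
Import Order.TTheory GRing.Theory Num.Theory.

Local Open Scope classical_set_scope.
Local Open Scope ring_scope.
Local Open Scope nat_scope.

Definition num_divisors (n : nat) : nat := size (divisors n).

(* One unit change of the exponent of exactly one prime p, towards the exponent
   of p in the target n. Since [logn q _ = 0] for non-prime q, the last clause
   is a condition on primes only. *)
Definition geodesic_step (n x y : nat) : Prop :=
  exists p, [/\ prime p,
    (logn p x < logn p n /\ logn p y = (logn p x).+1) \/
    (logn p n < logn p x /\ logn p x = (logn p y).+1) &
    forall q, q != p -> logn q y = logn q x].

Definition geodesic (m n : nat) (s : seq nat) : Prop :=
  [/\ ohead s = Some m, last m s = n, all (leq 1) s &
      forall i, i.+1 < size s -> geodesic_step n (nth 0 s i) (nth 0 s i.+1)].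

Definition admissible_geodesic (R : realDomainType) (X : R) (m n : nat)
    (s : seq nat) : Prop :=
  geodesic m n s /\ (forall z, z \in s -> (z%:R <= X)%R).

(* For nonempty s the default value is one of the terms, so this is the minimum
   of num_divisors over the vertices. *)
Definition bottleneck (s : seq nat) : nat :=
  \big[minn/num_divisors (head 0 s)]_(z <- s) num_divisors z.

Definition is_max (A : set nat) (v : nat) : Prop :=
  A v /\ forall w, A w -> w <= v.

(* The default value 0 is never used when X >= max(m, n) and m, n > 0, see
   [optimal_bottleneckP]. *)
Definition optimal_bottleneck (R : realDomainType) (X : R) (m n : nat) : nat :=
  xget 0 (is_max [set bottleneck s | s in admissible_geodesic X m n]).

Definition delta (k : nat) (a b : 'I_k -> nat) (i : 'I_k) : nat :=
  absz ((b i)%:Z - (a i)%:Z)%R.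

Definition sigma (k : nat) (a b : 'I_k -> nat) (i : 'I_k) : int :=
  sgz ((b i)%:Z - (a i)%:Z)%R.

(* The integer vectors r with 0 <= r i <= delta i. *)
Notation state a b := {dffun forall i, 'I_(delta a b i).+1}.

Definition state0 (k : nat) (a b : 'I_k -> nat) : state a b :=
  [ffun i => ord0].

Definition state_delta (k : nat) (a b : 'I_k -> nat) : state a b :=
  [ffun i => ord_max].

(* r - e_i, meaningful when 0 < r i. *)
Definition state_pred (k : nat) (a b : 'I_k -> nat) (r : state a b) (i : 'I_k) :
    state a b :=
  [ffun j => inord (r j - (j == i))].

(* a_i + sigma_i r_i; this integer is nonnegative, see [state_expE]. *)
Definition state_exp (k : nat) (a b : 'I_k -> nat) (r : state a b) (i : 'I_k) :
    nat :=
  absz ((a i)%:Z + sigma a b i * (r i : nat)%:Z)%R.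

Definition state_num (k : nat) (p a b : 'I_k -> nat) (r : state a b) : nat :=
  \prod_(i < k) p i ^ state_exp r i.

Definition state_div (k : nat) (a b : 'I_k -> nat) (r : state a b) : nat :=
  \prod_(i < k) (state_exp r i + 1).

Definition admissible (R : realDomainType) (X : R) (k : nat)
    (p a b : 'I_k -> nat) (r : state a b) : bool :=
  ((state_num p r)%:R <= X)%R.

(* The recursion defining F, with fuel t; see [dp_valueE] for the recursion
   itself. *)
Fixpoint dp_rec (R : realDomainType) (X : R) (k : nat) (p a b : 'I_k -> nat)
    (t : nat) (r : state a b) : nat :=
  if ~~ admissible X p r then 0
  else if r == state0 a b then state_div (state0 a b)
  else if t is t'.+1 then
    minn (state_div r)
         (\max_(i < k | (0 < r i) && admissible X p (state_pred r i))
            dp_rec X p t' (state_pred r i))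
  else 0.

Definition dp_value (R : realDomainType) (X : R) (k : nat)
    (p a b : 'I_k -> nat) (r : state a b) : nat :=
  dp_rec X p (\sum_(i < k) r i) r.

Lemma state_predE (k : nat) (a b : 'I_k -> nat) (r : state a b) (i j : 'I_k) :
  state_pred r i j = r j - (j == i) :> nat.
Proof. by rewrite ffunE inordK // ltnS (leq_trans (leq_subr _ _)) // -ltnS. Qed.

Lemma state_expE (k : nat) (a b : 'I_k -> nat) (r : state a b) (i : 'I_k) :
  (state_exp r i)%:Z = ((a i)%:Z + sigma a b i * (r i : nat)%:Z)%R.
Proof.
have := ltn_ord (r i); rewrite ltnS /state_exp /sigma => Hr.
rewrite gez0_abs //; move: (nat_of_ord (r i)) Hr => t; rewrite /delta.
by case: (sgzP ((b i)%:Z - (a i)%:Z)%R) => H; lia.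
Qed.

Lemma dp_valueE (R : realDomainType) (X : R) (k : nat) (p a b : 'I_k -> nat)
    (r : state a b) :
  dp_value X p r =
    if ~~ admissible X p r then 0
    else if r == state0 a b then state_div (state0 a b)
    else minn (state_div r)
           (\max_(i < k | (0 < r i) && admissible X p (state_pred r i))
              dp_value X p (state_pred r i)).
Proof.
rewrite {1}/dp_value; case E: (\sum_(i < k) r i) => [|t] /=.
  case: ifP => // _; case: eqP => // -[]; apply/ffunP => i.
  move/eqP: E; rewrite sum_nat_eq0 => /forallP /(_ i) /eqP ri.
  by apply: val_inj; rewrite ffunE /= ri.
case: ifP => // _; case: ifP => // _; congr minn.
apply: eq_bigr => i /andP[ri _]; rewrite /dp_value; congr dp_rec.
apply: succn_inj; rewrite -E (bigD1 i) //= [in RHS](bigD1 i) //= -addSn.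
rewrite state_predE eqxx subn1 prednK //; congr addn.
by apply: eq_bigr => j /negbTE ji; rewrite state_predE ji subn0.
Qed.

Lemma geodesic_cons (m n x : nat) (s : seq nat) :
  0 < m -> geodesic_step n m x -> geodesic x n s -> geodesic m n (m :: s).
Proof.
move=> m0 st [hs ls ps ss]; case: s hs ls ps ss => // y s [->] ls ps ss.
split => //=; first by rewrite m0.
by case=> [|i] //= Hi; apply: ss.
Qed.

Lemma geodesic_exists (m n : nat) : 0 < m -> 0 < n ->
  exists2 s, geodesic m n s & forall z, z \in s -> z <= maxn m n.
Proof.
move=> m0 n0.
have up : forall t x, n - x <= t -> x %| n -> 0 < x ->
    exists2 s, geodesic x n s & forall z, z \in s -> z <= n.
  elim=> [|t IH] x le_t xn x0; have x_le := dvdn_leq n0 xn.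
    have -> : x = n by lia.
    by exists [:: n] => [|z]; [split; rewrite /= ?n0 | rewrite inE => /eqP ->].
  case/dvdnP: (xn) => c En; have c0 : 0 < c by move: n0; rewrite En; case: (c).
  have [c1|c1] := leqP c 1.
    have c1E : c = 1 by lia.
    apply: IH => //; by rewrite En c1E mul1n subnn.
  have pp := pdiv_prime c1; set p := pdiv c in pp.
  have p1 := prime_gt1 pp; have p0 := prime_gt0 pp.
  have px0 : 0 < p * x by rewrite muln_gt0 p0.
  have px : x < p * x by rewrite ltn_Pmull.
  have pn : p * x %| n by rewrite En dvdn_pmul2r // pdiv_dvd.
  have [|//|//|s gs bs] := IH (p * x); first by have := dvdn_leq n0 pn; lia.
  exists (x :: s); last by move=> z; rewrite inE => /orP[/eqP ->|/bs].
  apply: geodesic_cons gs => //; exists p; split => //.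
    left; rewrite lognM // (logn_prime _ pp) eqxx; split => //.
    by have := dvdn_leq_log p n0 pn; rewrite lognM // (logn_prime _ pp) eqxx.
  move=> q qp; rewrite lognM // (logn_prime _ pp).
  by rewrite (negbTE qp).
have [s gs bs] : exists2 s, geodesic m n s &
    forall z, z \in s -> z <= m \/ z <= n.
  have [t] := ubnP m; elim: t m m0 => // t IH m m0 lt_t.
  have [mn|mn] := boolP (m %| n).
    have [s gs bs] := up _ m (leqnn _) mn m0.
    by exists s => // z /bs; right.
  have [p pp lp] : exists2 p, prime p & logn p n < logn p m.
    apply: contrapT => H; move/negP: mn; apply; apply/dvdn_partP => // p.
    rewrite mem_primes => /and3P[pp _ _]; rewrite p_part pfactor_dvdn // leqNgt.
    by apply/negP => lp; apply: H; exists p.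
  have : p \in primes m by rewrite -logn_gt0 (leq_ltn_trans _ lp).
  rewrite mem_primes => /and3P[_ _ /dvdnP[y Em]].
  have p1 := prime_gt1 pp; have p0 := prime_gt0 pp.
  have y0 : 0 < y by move: m0; rewrite Em; case: (y).
  have ym : y < m by rewrite Em ltn_Pmulr.
  have [|s gs bs] := IH y y0; first by lia.
  exists (m :: s).
    apply: geodesic_cons gs => //; exists p; split => //.
      by right; rewrite {2}Em lognM // (logn_prime _ pp) eqxx addn1.
    move=> q qp; rewrite Em lognM // (logn_prime _ pp).
    by rewrite (negbTE qp) addn0.
  move=> z; rewrite inE => /orP[/eqP ->|/bs[]]; first by left.
    by left; apply: leq_trans (ltnW ym).
  by right.
exists s => // z /bs; rewrite leq_max => -[->|->] //; exact: orbT.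
Qed.

Lemma optimal_bottleneckP (R : realDomainType) (X : R) (m n : nat) :
  0 < m -> 0 < n -> ((maxn m n)%:R <= X)%R ->
  is_max [set bottleneck s | s in admissible_geodesic X m n]
         (optimal_bottleneck X m n).
Proof.
move=> m0 n0 hX; apply: xgetPex.
set A := (X in is_max X).
have [s gs bs] := geodesic_exists m0 n0.
have exA : exists v, `[< A v >].
  exists (bottleneck s); apply/asboolP; exists s => //; split => // z /bs zmn.
  by apply: le_trans hX; rewrite ler_nat.
have ubA v : `[< A v >] -> v <= num_divisors m.
  move=> /asboolP[s' [[hs _ _ _] _] <-]; case: s' hs => //= x s' [->].
  rewrite /bottleneck big_cons; exact: geq_minl.
case: (ex_maxnP exA ubA) => v /asboolP Av Hv.
by exists v; split => // w Aw; apply: Hv; apply/asboolP.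
Qed.

(* Main.v *)
(* By unique factorization the vertices of a geodesic are the numbers N(r) of
   states r, and a geodesic step from N(r) leads exactly to some N(r + e_i).
   Hence F(r) is the largest v such that some admissible initial segment of a
   geodesic from m to N(r) has all its divisor counts at least v: extending
   segments by one vertex gives one inequality, and following a maximizing
   predecessor in the recursion gives the other. *)
Require Import Defs.
From mathcomp Require Import all_boot all_order all_algebra.
From mathcomp Require Import boolp zify.
Set Implicit Arguments.
Unset Strict Implicit.
Unset Printing Implicit Defensive.
Local Open Scope nat_scope.

(** Serves twice: it counts the states, and it counts the exponent vectors of the divisors of a
    product of prime powers. *)
Lemma card_dffun_ord (k : nat) (e : 'I_k -> nat) :
  #|{dffun forall i, 'I_(e i).+1}| = \prod_(i < k) (e i).+1.
Proof.
rewrite card_dep_ffun /image_mem foldrE big_map enumT.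
by apply: eq_bigr => i _; rewrite card_ord.
Qed.

(** * Valuations and divisors of products of powers of distinct primes *)

Section PrimeProducts.
Variables (k : nat) (p : 'I_k -> nat).
Hypotheses (p_prime : forall i, prime (p i)) (p_inj : injective p).
Implicit Type e : 'I_k -> nat.

Lemma prod_expn_gt0 e : 0 < \prod_(i < k) p i ^ e i.
Proof. by apply: prodn_gt0 => i; rewrite expn_gt0 prime_gt0. Qed.

Lemma logn_prod_expn q e : prime q ->
  logn q (\prod_(i < k) p i ^ e i) = \sum_(i < k | p i == q) e i.
Proof.
(* Positivity is carried along with the valuation because [lognM] needs both factors positive. *)
move=> q_pr; pose P x y := (0 < x) && (logn q x == y).
suff /andP[_ /eqP //] : P (\prod_(i < k) p i ^ e i) (\sum_(i < k | p i == q) e i).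
rewrite [X in P _ X]big_mkcond; apply: (big_ind2 P) => [|x y x' y'|i _].
- by rewrite /P logn1 eqxx.
- move=> /andP[x0 /eqP <-] /andP[y0 /eqP <-].
  by rewrite /P muln_gt0 x0 y0 lognM //=.
- rewrite /P expn_gt0 prime_gt0 // lognX logn_prime // [q == _]eq_sym; case: ifP => _.
    by rewrite muln1 eqxx.
  by rewrite muln0.
Qed.

Lemma logn_prod_expn_in e i : logn (p i) (\prod_(j < k) p j ^ e j) = e i.
Proof.
rewrite logn_prod_expn //; under eq_bigl do rewrite (inj_eq p_inj).
by rewrite big_pred1_eq.
Qed.

Lemma logn_prod_expn_notin q e : (forall i, p i != q) ->
  logn q (\prod_(i < k) p i ^ e i) = 0.
Proof.
move=> qP; have [q_pr|/negbTE q_npr] := boolP (prime q); last by rewrite /logn q_npr.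
by rewrite logn_prod_expn // big1 // => i /idPn[]; rewrite qP.
Qed.

(** Unique factorization, in the form that recognizes a divisor or a geodesic vertex from its
    valuations. *)
Lemma prod_expn_eq x e : 0 < x -> (forall i, logn (p i) x = e i) ->
  (forall q, prime q -> (forall i, p i != q) -> logn q x = 0) ->
  x = \prod_(i < k) p i ^ e i.
Proof.
move=> x0 xin xout; apply: eqn_from_log => // [|q]; first exact: prod_expn_gt0.
have [[i <-]|/forallNP qP] := pselect (exists i, p i = q).
  by rewrite logn_prod_expn_in.
have {}qP i : p i != q by apply/eqP.
rewrite logn_prod_expn_notin //.
by have [/xout->|/negbTE q_npr] := boolP (prime q); last by rewrite /logn q_npr.
Qed.

(** Sending an exponent vector bounded by [e] to its product [g] is a bijection onto the divisors:
    valuations give injectivity and recover the preimage of a divisor. *)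
Lemma num_divisors_prod_expn e :
  num_divisors (\prod_(i < k) p i ^ e i) = \prod_(i < k) (e i).+1.
Proof.
rewrite -card_dffun_ord cardE /num_divisors.
pose g (f : {dffun forall i, 'I_(e i).+1}) := \prod_(i < k) p i ^ f i.
rewrite -(size_map g); apply: perm_size; apply: uniq_perm.
- exact: divisors_uniq.
- rewrite map_inj_uniq ?enum_uniq // => f f' /(congr1 (fun x => logn (p _) x)) ff'.
  apply/ffunP => i; apply: val_inj.
  by have := ff' i; rewrite !logn_prod_expn_in.
move=> d; rewrite -dvdn_divisors ?prod_expn_gt0 //; apply/idP/mapP; last first.
  case=> f _ ->; apply: (big_ind2 (fun x y => x %| y)) => // [x y x' y'|i _].
    exact: dvdn_mul.
  by rewrite dvdn_exp2l // -ltnS.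
move=> dN; have lg q := dvdn_leq_log q (prod_expn_gt0 e) dN.
have dE i : logn (p i) d < (e i).+1.
  by rewrite ltnS -[e i]logn_prod_expn_in.
exists [ffun i => Ordinal (dE i)]; rewrite ?mem_enum //.
apply: prod_expn_eq; first exact: dvdn_gt0 (prod_expn_gt0 e) dN.
  by move=> i; rewrite ffunE.
by move=> q _ qP; have := lg q; rewrite logn_prod_expn_notin // leqn0 => /eqP.
Qed.

End PrimeProducts.

(** * Bottlenecks and geodesics in list form *)

(** The default of the iterated minimum is the term of the head [x], so it adds no constraint of its
    own. *)
Lemma leq_bottleneck v x s :
  (v <= bottleneck (x :: s)) = all (fun z => v <= num_divisors z) (x :: s).
Proof.
rewrite /bottleneck /=; have -> : forall t,
  (v <= \big[minn/num_divisors x]_(z <- t) num_divisors z) =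
    (v <= num_divisors x) && all (fun z => v <= num_divisors z) t.
  elim=> [|y t IH]; first by rewrite big_nil andbT.
  by rewrite big_cons leq_min IH /= andbCA.
by rewrite /= andbA andbb.
Qed.

(** The [path] form supports induction from the right end, which matches a recursion that looks back
    at predecessors. *)
Lemma geodesicP m n s :
  geodesic m n s <-> exists2 t, s = m :: t &
    [/\ path (fun x y => `[< geodesic_step n x y >]) m t, last m t = n
      & all (leq 1) (m :: t)].
Proof.
split=> [[]|[t -> [/(pathP 0) st ls ps]]].
  case: s => //= x t [->] ls ps st; exists t => //; split => //.
  by apply/(pathP 0) => i it; apply/asboolP/(st i).
by split => // i /st/asboolP.
Qed.

(** * States as vertices of geodesics *)

Section StateSpace.
Variables (k : nat) (p a b : 'I_k -> nat).
Hypotheses (p_prime : forall i, prime (p i)) (p_inj : injective p).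
Implicit Type r : state a b.

(** Eliminates signs and integers. The subtraction is never truncated, since there [r i] is at most
    [a i - b i]. *)
Lemma state_exp_nat r i :
  state_exp r i = if a i <= b i then a i + r i else a i - r i.
Proof.
have := state_expE r i; rewrite /sigma.
have := ltn_ord (r i); rewrite ltnS; move: (nat_of_ord _) => t.
rewrite /delta; case: (sgzP ((b i)%:Z - (a i)%:Z)%R) => H; case: ifP; lia.
Qed.

Lemma state_leq_delta r i : r i <= delta a b i.
Proof. by rewrite -ltnS. Qed.

Lemma state_exp0 i : state_exp (state0 a b) i = a i.
Proof. by rewrite state_exp_nat ffunE /= addn0 subn0 if_same. Qed.

Lemma state_exp_delta i : state_exp (state_delta a b) i = b i.
Proof. by rewrite state_exp_nat ffunE /= /delta; case: ifP; lia. Qed.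

Lemma state_exp_inj r r' : (forall i, state_exp r i = state_exp r' i) -> r = r'.
Proof.
move=> rr'; apply/ffunP => i; apply: val_inj; have := rr' i.
rewrite !state_exp_nat; have := state_leq_delta r i; have := state_leq_delta r' i.
rewrite /delta /=; case: ifP; lia.
Qed.

Lemma state_num0 : state_num p (state0 a b) = \prod_(i < k) p i ^ a i.
Proof. by apply: eq_bigr => i _; rewrite state_exp0. Qed.

Lemma state_num_delta : state_num p (state_delta a b) = \prod_(i < k) p i ^ b i.
Proof. by apply: eq_bigr => i _; rewrite state_exp_delta. Qed.

Lemma state_num_gt0 r : 0 < state_num p r.
Proof. exact: prod_expn_gt0. Qed.

Lemma state_num_inj : injective (@state_num k p a b).
Proof.
move=> r r' rr'; apply: state_exp_inj => i.
have := congr1 (logn (p i)) rr'.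
by rewrite /state_num !logn_prod_expn_in.
Qed.

Lemma num_divisors_state_num r : num_divisors (state_num p r) = state_div r.
Proof.
rewrite num_divisors_prod_expn //.
by apply: eq_bigr => i _; rewrite addn1.
Qed.

Lemma geodesic_step_state_pred r i : 0 < r i ->
  geodesic_step (\prod_(j < k) p j ^ b j)
    (state_num p (state_pred r i)) (state_num p r).
Proof.
move=> ri; exists (p i); split; first exact: p_prime.
  rewrite /state_num !logn_prod_expn_in // !state_exp_nat state_predE eqxx subn1.
  move: ri (state_leq_delta r i); rewrite /delta; move: (nat_of_ord (r i)) => t.
  by case: ifP; lia.
move=> q qi; rewrite /state_num.
have [[j qj]|/forallNP qP] := pselect (exists j, p j = q).
  subst q; rewrite !logn_prod_expn_in // !state_exp_nat state_predE.
  by rewrite -(inj_eq p_inj) (negbTE qi) subn0.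
by rewrite !logn_prod_expn_notin // => j; apply/eqP.
Qed.

(** A step strictly approaches the target exponent, so the coordinate that moves is still below its
    bound [delta a b i] and can be incremented within the state space. *)
Lemma geodesic_step_state r y : 0 < y ->
  geodesic_step (\prod_(j < k) p j ^ b j) (state_num p r) y ->
  exists r' i, [/\ 0 < r' i, state_pred r' i = r & state_num p r' = y].
Proof.
move=> y0 [q [q_pr towards same]].
have [[i qi]|/forallNP qP] := pselect (exists i, p i = q); last first.
  have {}qP i : p i != q by apply/eqP.
  (* At a prime outside the family, current and target exponents are both 0, so no step can use
     it. *)
  by move: towards; rewrite /state_num !logn_prod_expn_notin // !ltnn; case=> -[].
subst q; have [ri ly] : r i < delta a b i /\
    logn (p i) y = if a i <= b i then a i + (r i).+1 else a i - (r i).+1.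
  move: towards; rewrite /state_num !logn_prod_expn_in // state_exp_nat.
  move: (state_leq_delta r i); rewrite /delta; move: (nat_of_ord (r i)) => t.
  by case: ifP; lia.
(* This is r + e_i; [inord] does not fall back to its default, because [r i < delta a b i]. *)
pose r' : state a b := [ffun j => inord (r j + (j == i))].
have r'E j : r' j = r j + (j == i) :> nat.
  rewrite ffunE inordK // ltnS; case: eqP => [->|_]; first by rewrite addn1.
  by rewrite addn0 state_leq_delta.
exists r', i; split; first by rewrite r'E eqxx addn1.
  by apply/ffunP => j; apply: val_inj; rewrite /= state_predE r'E addnK.
apply/esym/prod_expn_eq => // [j|q q_pr' qP].
  have [->|ji] := eqVneq j i.
    by rewrite state_exp_nat r'E eqxx addn1.
  rewrite same ?(inj_eq p_inj) // logn_prod_expn_in //.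
  by rewrite !state_exp_nat r'E (negbTE ji) addn0.
by rewrite same 1?eq_sym // logn_prod_expn_notin.
Qed.

(** * The recursion compared with admissible paths *)

Variables (R : realDomainType) (X : R).

Lemma dp_value_state0 : admissible X p (state0 a b) ->
  dp_value X p (state0 a b) = state_div (state0 a b).
Proof. by rewrite dp_valueE eqxx => ->. Qed.

(** The endpoint is left arbitrary so that induction applies to initial segments; only the steps
    refer to the final target. *)
Lemma dp_value_ge_path v t :
  path (fun x y => `[< geodesic_step (\prod_(j < k) p j ^ b j) x y >])
    (\prod_(j < k) p j ^ a j) t ->
  {in (\prod_(j < k) p j ^ a j) :: t, forall z,
     [/\ 0 < z, (z%:R <= X)%R & v <= num_divisors z]} ->
  exists2 r : state a b, state_num p r = last (\prod_(j < k) p j ^ a j) t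
    & v <= dp_value X p r.
Proof.
rewrite -state_num0; set m := state_num p _.
elim/last_ind: t => [_ /(_ m)|t y IH].
  case=> [|_ mX vm]; first exact: mem_head.
  exists (state0 a b) => //.
  by rewrite dp_value_state0 // -num_divisors_state_num.
rewrite rcons_path last_rcons => /andP[/IH{}IH /asboolP st] tP.
have [|r rE vr] := IH.
  by move=> z zt; apply: tP; rewrite -rcons_cons mem_rcons inE zt orbT.
have [|y0 yX vy] := tP y; first by rewrite -rcons_cons mem_rcons mem_head.
move: st; rewrite -rE => /(geodesic_step_state y0)[r' [i [r'i r'r r'y]]].
exists r' => //; rewrite dp_valueE /admissible r'y yX /=.
case: eqP => [r'0|_]; first by move: r'i; rewrite r'0 ffunE.
rewrite leq_min -num_divisors_state_num r'y vy /=.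
(* The value at the previous vertex is one term of the maximum; that vertex lies on the path, hence
   is admissible. *)
rewrite -r'r in vr; apply: leq_trans vr _.
apply: (@leq_bigmax_cond _ _ (fun i => dp_value X p (state_pred r' i))).
rewrite r'i /= r'r /admissible rE.
have [] // := tP (last m t).
by rewrite -rcons_cons mem_rcons inE mem_last orbT.
Qed.

(** A positive value rules out inadmissible states and empty maxima, so a maximizing predecessor can
    be followed back to the origin. *)
Lemma dp_value_path r : 0 < dp_value X p r ->
  exists t, [/\
    path (fun x y => `[< geodesic_step (\prod_(j < k) p j ^ b j) x y >])
      (\prod_(j < k) p j ^ a j) t,
    last (\prod_(j < k) p j ^ a j) t = state_num p r &
    {in (\prod_(j < k) p j ^ a j) :: t, forall z,
     [/\ 0 < z, (z%:R <= X)%R & dp_value X p r <= num_divisors z]}].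
Proof.
rewrite -state_num0; set m := state_num p _.
have [w] := ubnP (\sum_(i < k) r i); elim: w r => // w IH r lt_w.
rewrite dp_valueE; case: ifP => // /negbFE rX; case: eqP => [r0|_] F0.
  exists [::]; split => // [|z]; first by rewrite r0.
  rewrite inE => /eqP ->.
  by rewrite num_divisors_state_num state_num_gt0; split => //; rewrite /m -r0.
set M := (X in minn _ X) in F0 *.
have M0 : 0 < M by rewrite (leq_trans F0) // geq_minr.
have [i /andP[ri pX] ME] : exists2 i, (0 < r i) && admissible X p (state_pred r i)
    & M = dp_value X p (state_pred r i).
  have [|i iP ME] := @eq_bigmax_cond _
    [pred i | (0 < r i) && admissible X p (state_pred r i)]
    (fun i => dp_value X p (state_pred r i)); last by exists i.
  (* With no admissible predecessor the maximum would be 0, against [M0]. *)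
  rewrite lt0n; apply/negP => /eqP/card0_eq P0; move: M0; rewrite /M big_pred0 //.
have [||t [pt lt tP]] := IH (state_pred r i).
(* The coordinate sum drops by one, which is the induction measure. *)
- move: lt_w; rewrite (bigD1 i) //= [X in _ -> X < _](bigD1 i) //= state_predE eqxx.
  rewrite -{1}(prednK ri) addSn ltnS subn1; congr (_ + _ < w); apply: eq_bigr.
  by move=> j /negbTE ji; rewrite state_predE ji subn0.
- by rewrite -ME.
exists (rcons t (state_num p r)); split; last 1 first.
- move=> z; rewrite -rcons_cons mem_rcons inE => /predU1P[->|/tP[z0 zX]].
    by split; rewrite ?state_num_gt0 // num_divisors_state_num geq_minl.
  by rewrite -ME => Mz; split=> //; apply: leq_trans Mz; apply: geq_minr.
- by rewrite rcons_path pt lt; apply/asboolP/geodesic_step_state_pred.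
- by rewrite last_rcons.
Qed.

End StateSpace.

Theorem theorem2p3 (R : realDomainType) (X : R) (m n k : nat)
    (p a b : 'I_k -> nat)
    (hm : 0 < m) (hn : 0 < n)
    (p_prime : forall i, prime (p i)) (p_inj : injective p)
    (p_all : forall q, prime q -> q %| m * n -> exists i, q = p i)
    (m_def : m = \prod_(i < k) p i ^ a i)
    (n_def : n = \prod_(i < k) p i ^ b i)
    (hX : ((maxn m n)%:R <= X)%R) :
  dp_value X p (state_delta a b) = optimal_bottleneck X m n /\
  #|{: state a b}| = \prod_(i < k) (delta a b i + 1).
Proof.
split; last by rewrite card_dffun_ord; apply: eq_bigr => i _; rewrite addn1.
have [[s [/geodesicP[t sE [pt lt t0]] sX] sG] Gmax] := optimal_bottleneckP hm hn hX.
apply/eqP; rewrite eqn_leq; apply/andP; split.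
  (* A zero value is trivially a lower bound; a positive one is realized by a geodesic that competes
     in the maximum. *)
  have [->//|F0] := posnP (dp_value X p (state_delta a b)).
  have [u [pu lu uP]] := dp_value_path p_prime p_inj F0.
  rewrite -m_def -n_def state_num_delta -n_def in pu lu uP.
  apply: (@leq_trans (bottleneck (m :: u))).
    by rewrite leq_bottleneck; apply/allP => z /uP[].
  apply: Gmax; exists (m :: u) => //; split; last by move=> z /uP[].
  apply/geodesicP; exists u => //; split => //.
  by apply/allP => z /uP[].
(* Conversely, the optimal geodesic is fed to the path bound with [v] equal to its bottleneck. *)
rewrite m_def n_def in pt.
have [|r rE] := @dp_value_ge_path _ _ _ _ p_prime p_inj _ X (optimal_bottleneck X m n) _ pt.
  rewrite -m_def => z zt; split; first exact: (allP t0).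
    by apply: sX; rewrite sE.
  move: (leqnn (optimal_bottleneck X m n)); rewrite -{2}sG sE leq_bottleneck.
  by move/allP; apply.
(* Both states have the number [n], and a state is determined by its number. *)
suff -> : r = state_delta a b by [].
by apply: (state_num_inj p_prime p_inj); rewrite rE state_num_delta -m_def lt.
Qed.
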